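(* For every integer $k\geq 1$ and every $1\leq p\leq\infty$ there exists a constant $C_{k,p}$, depending only on $k$ and $p$, such that for every finite subset $A\subset\mathbb{Z}$ with characteristic function $\chi_A$, $$\|(\mathbf{M}^d\chi_A)^{(k)}\|_{l^p(\mathbb{Z})}\leq C_{k,p}\,\|\chi_A^{(k)}\|_{l^p(\mathbb{Z})}.$$
   Context: For $f:\mathbb{Z}\to\mathbb{R}$ and an integer $k\geq 1$, the discrete derivative (forward difference) of order $k$ is $f^{(k)}(n):=\sum_{j=0}^{k}\binom{k}{j}(-1)^{j}f(n+k-j)$, $n\in\mathbb{Z}$. The discrete noncentered Hardy-Littlewood maximal function of $f:\mathbb{Z}\to\mathbb{R}$ is $$\mathbf{M}^d f(n):=\sup_{r,s\in\mathbb{Z}^+}\frac{1}{r+s+1}\sum_{j=-r}^{s}|f(n+j)|,\qquad n\in\mathbb{Z},$$ where $\mathbb{Z}^+$ denotes the set of nonnegative integers. *)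

(* Defs.v *)
From HB Require Import structures.
From mathcomp Require Import all_boot all_order all_algebra.
From mathcomp Require Import all_classical all_reals all_analysis.

Set Implicit Arguments.
Unset Strict Implicit.
Unset Printing Implicit Defensive.

Import Order.TTheory GRing.Theory Num.Theory.

Local Open Scope classical_set_scope.
Local Open Scope ring_scope.

(* The discrete sigma-algebra on int, so that the library's L^p norm can be
   taken with respect to the counting measure on int. *)
HB.instance Definition _ := isPointed.Build int 0.
HB.instance Definition _ := @isMeasurable.Build default_measure_display
  int discrete_measurable discrete_measurable0
  discrete_measurableC discrete_measurableU.

Definition fdiff (R : realType) (k : nat) (f : int -> R) (n : int) : R :=
  \sum_(j < k.+1) 'C(k, j)%:R * (-1) ^+ j * f (n + k%:Z - j%:Z).

(* The mean of |f| over {n - r, ..., n + s}; the summation index is i = j + r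
   with j running from - r to s. *)
Definition avg (R : realType) (f : int -> R) (n : int) (r s : nat) : R :=
  (r + s + 1)%:R^-1 * \sum_(i < r + s + 1) `|f (n + (i%:Z - r%:Z))|.

(* [sup] is the supremum in R, and is 0 by convention on sets with no upper
   bound, so this is the (possibly infinite) maximal function only where the
   means are bounded, e.g. for every bounded f (cf. [has_sup_avg]). *)
Definition maxfun (R : realType) (f : int -> R) (n : int) : R :=
  sup [set avg f n rs.1 rs.2 | rs in [set: nat * nat]].

Lemma has_sup_avg (R : realType) (f : int -> R) (M : R) (n : int) :
  (forall m, `|f m| <= M) ->
  has_sup [set avg f n rs.1 rs.2 | rs in [set: nat * nat]].
Proof.
move=> fM; split; first by exists (avg f n 0 0), (0, 0)%N.
exists M => _ [[r s] _ <-]; rewrite /avg /= mulrC ler_pdivrMr; last first.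
  by rewrite ltr0n addn1.
rewrite -[X in _ * X%:R]card_ord mulr_natr -sumr_const.
exact: ler_sum.
Qed.

(* Meant for 1 <= p, with p = +oo allowed; the value is +oo when f is not in l^p. *)
Definition lpnorm (R : realType) (p : \bar R) (f : int -> R) : \bar R :=
  'N[counting]_p[EFin \o f].

(* Main.v *)
Require Import Defs.
From HB Require Import structures.
From mathcomp Require Import all_boot all_order all_algebra.
From mathcomp Require Import all_classical all_reals all_analysis.
From mathcomp Require Import ess_sup_inf.
From mathcomp Require Import zify ring lra.
Import Order.TTheory GRing.Theory Num.Theory.
Local Open Scope classical_set_scope.
Local Open Scope ring_scope.

(** For an indicator function both sides of the inequality can be compared with
    the number of jumps of [\1_A], that is with its variation.

    Upper bound.  The maximal function [g] of [\1_A] takes values in [0, 1],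
    so [|fdiff k.+1 g|] is at most [2 ^+ k.+1], its [r]-th power is at most a
    constant times its first power ([powR_le_linear]), and its l^1 norm is at
    most [2 ^+ k] times the variation of [g] ([wsum_fdiff]).  On [A] the function
    [g] is constant equal to 1.  On a gap of [A] it is quasiconvex
    ([maxfun_quasiconvex]): an interval around a point [n] of the gap either
    reaches an endpoint [a] or [b] of the gap, and then its mean is one of those
    competing in the supremum [g a] or [g b], or it misses [A] and has mean 0.
    A quasiconvex function first decreases and then increases, so each gap
    contributes at most 2, and the variation of [g] is bounded linearly in the
    number of jumps of [\1_A] ([wvar_maxfun_indic]).

    Lower bound.  Let [h] be bounded by 1 with integer values.  If
    [fdiff k.+1 h] vanishes on a window of length [L], then [fdiff k h] is
    constant there; this constant is the slope of [fdiff k.-1 h], which is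
    bounded, so for [L] large enough ([2 ^ k.+1] will do) the slope is less than
    1 in absolute value, and being an integer it is 0.  Repeating this brings the
    order down to 1 ([fdiff_eq0_descent]).  Hence each jump of [\1_A] is followed
    within [2 ^ k.+1] steps by a point where the integer [fdiff k.+1 \1_A] is at
    least 1 in absolute value ([fdiff_indic_neq0]), and the number of jumps is
    at most [2 ^ k.+1] times the sum of [|fdiff k.+1 \1_A| `^ r].

    A nonempty finite set has at least one jump ([exists_jump]), which absorbs
    the additive constants of the upper bound and settles the case [p = +oo];
    for the empty set the left-hand side is 0. *)

(** * Sums over windows and finite differences *)

Definition fdiff1 {R : realType} (h : int -> R) (n : int) : R :=
  h (n + 1) - h n.

(** Inequalities between sums over the integers are proved as inequalities
    between finite sums over windows [[u, u + N)]; a translation costs only an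
    enlargement of the window on the right. *)
Definition wsum {R : realType} (u : int) (N : nat) (h : int -> R) : R :=
  \sum_(i < N) h (u + i%:Z).

Definition wvar {R : realType} (u : int) (N : nat) (h : int -> R) : R :=
  wsum u N (fun n => `|fdiff1 h n|).

Section Windows.
Context {R : realType}.
Implicit Types (u n : int) (N M : nat) (h : int -> R).

Lemma wsumS u N h : wsum u N.+1 h = wsum u N h + h (u + N%:Z).
Proof. by rewrite /wsum big_ord_recr. Qed.

Lemma wsum1 u h : wsum u 1 h = h u.
Proof. by rewrite /wsum big_ord1 addr0. Qed.

Lemma wsum_cat u N M h : wsum u (N + M) h = wsum u N h + wsum (u + N%:Z) M h.
Proof.
elim: M => [|M IH]; first by rewrite addn0 /wsum big_ord0 addr0.
by rewrite addnS !wsumS IH -!addrA PoszD.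
Qed.

Lemma wsumSl u N h : wsum u N.+1 h = h u + wsum (u + 1) N h.
Proof. by rewrite -add1n wsum_cat wsum1. Qed.

Lemma wsum_ge0 u N h : (forall n, 0 <= h n) -> 0 <= wsum u N h.
Proof. by move=> h0; apply: sumr_ge0. Qed.

Lemma wsum_le u N h h' : (forall n, h n <= h' n) -> wsum u N h <= wsum u N h'.
Proof. by move=> hh'; apply: ler_sum. Qed.

Lemma wsum_scale u N h (c : R) : wsum u N (fun n => c * h n) = c * wsum u N h.
Proof. by rewrite /wsum mulr_sumr. Qed.

Lemma wsum_sub u v N M h : (forall n, 0 <= h n) ->
  u <= v -> v + N%:Z <= u + M%:Z -> wsum v N h <= wsum u M h.
Proof.
move=> h0 uv vu.
have -> : v = u + `|v - u|%N%:Z by lia.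
have -> : M = (`|v - u| + (N + (M - (`|v - u| + N))))%N by lia.
rewrite !wsum_cat.
have a := wsum_ge0 u `|v - u|%N h h0.
have b := wsum_ge0 (u + `|v - u|%N + N%:Z) (M - (`|v - u| + N))%N h h0.
lra.
Qed.

Lemma wsum_shift u N k i h : (forall n, 0 <= h n) -> (i <= k)%N ->
  wsum u N (fun n => h (n + i%:Z)) <= wsum u (N + k) h.
Proof.
move=> h0 ik.
have -> : wsum u N (fun n => h (n + i%:Z)) = wsum (u + i%:Z) N h.
  by apply: eq_bigr => j _; rewrite addrAC.
by apply: wsum_sub => //; lia.
Qed.

Lemma wsum_moving u N k h : (forall n, 0 <= h n) ->
  wsum u N (fun n => wsum n k h) <= k%:R * wsum u (N + k) h.
Proof.
move=> h0; rewrite {1}/wsum exchange_big /=.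
apply: (@le_trans _ _ (\sum_(i < k) wsum u (N + k) h)).
  apply: ler_sum => i _; apply: (wsum_shift _ _ k i) => //.
  exact/ltnW/ltn_ord.
by rewrite sumr_const card_ord mulr_natl.
Qed.

Lemma wvar_cat u N M h :
  wvar u (N + M) h = wvar u N h + wvar (u + N%:Z) M h.
Proof. exact: wsum_cat. Qed.

Lemma wsum_fdiff1 u N h : wsum u N (fdiff1 h) = h (u + N%:Z) - h u.
Proof.
elim: N => [|N IH]; first by rewrite /wsum big_ord0 addr0 subrr.
have e : u + N.+1%:Z = u + N%:Z + 1 by lia.
by rewrite wsumS IH /fdiff1 e; ring.
Qed.

Lemma fdiff0 h n : fdiff 0 h n = h n.
Proof. by rewrite /fdiff big_ord1 /= expr0 !mul1r subr0 addr0. Qed.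

(** Pascal's rule. *)
Lemma fdiffS k h n : fdiff k.+1 h n = fdiff1 (fdiff k h) n.
Proof.
rewrite /fdiff1 /fdiff.
rewrite big_ord_recl /=.
under eq_bigr => i _ do rewrite /bump leq0n add1n binS natrD !mulrDl.
rewrite big_split /= addrA; congr (_ + _); last first.
  rewrite -sumrN; apply: eq_bigr => i _.
  rewrite exprS; have -> : n + k.+1%:Z - i.+1%:Z = n + k%:Z - i%:Z by lia.
  by ring.
rewrite [RHS]big_ord_recl /= big_ord_recr /= [X in _ + (_ + X)](_ : _ = 0); last first.
  by rewrite bin_small // !mul0r.
congr (_ + _).
  by rewrite !bin0; congr (_ * h _); lia.
by rewrite addr0; apply: eq_bigr => i _; rewrite /bump leq0n add1n; congr (_ * h _); lia.
Qed.

Lemma fdiff_fdiff1 k h n : fdiff k.+1 h n = fdiff k (fdiff1 h) n.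
Proof.
elim: k n => [|k IH] n; first by rewrite fdiffS /fdiff1 !fdiff0.
by rewrite fdiffS [RHS]fdiffS /fdiff1 !IH.
Qed.

Lemma fdiff_bound k h (B : R) : (forall n, `|h n| <= B) ->
  forall n, `|fdiff k h n| <= 2 ^+ k * B.
Proof.
move=> hB; elim: k => [|k IH] n; first by rewrite fdiff0 expr0 mul1r.
rewrite fdiffS /fdiff1 (le_trans (ler_normB _ _))//.
by have := IH n; have := IH (n + 1); rewrite exprS; lra.
Qed.

Lemma wsum_fdiff k u N h :
  wsum u N (fun n => `|fdiff k h n|) <= 2 ^+ k * wsum u (N + k) (fun n => `|h n|).
Proof.
elim: k u N => [|k IH] u N.
  by rewrite expr0 mul1r addn0; apply: wsum_le => n; rewrite fdiff0.
have h0 n : 0 <= `|fdiff k h n| by [].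
have H : wsum u N (fun n => `|fdiff k.+1 h n|) <=
    wsum u N (fun n => `|fdiff k h (n + 1)|) + wsum u N (fun n => `|fdiff k h n|).
  rewrite /wsum -big_split; apply: ler_sum => i _ /=.
  by rewrite fdiffS; exact: ler_normB.
have H1 := wsum_shift u N 1 1 (fun n => `|fdiff k h n|) h0 (leqnn 1).
have H2 : wsum u N (fun n => `|fdiff k h n|) <= wsum u (N + 1) (fun n => `|fdiff k h n|).
  by apply: wsum_sub => //; lia.
have := IH u (N + 1)%N; rewrite -addnA add1n exprS; simpl in *; lra.
Qed.

End Windows.

(** * The maximal function of an indicator *)
Section MaximalFunction.
Context {R : realType}.
Implicit Types (A : set int) (n u : int) (N : nat).

Lemma avg_ge0 (f : int -> R) n r s : 0 <= avg f n r s.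
Proof. by rewrite /avg mulr_ge0 ?invr_ge0 ?sumr_ge0. Qed.

Lemma avg_indic_le1 A n r s : avg (\1_A : int -> R) n r s <= 1.
Proof.
rewrite /avg mulrC ler_pdivrMr ?ltr0n ?addn1// mul1r.
rewrite -[X in _ <= X%:R]card_ord -sumr_const; apply: ler_sum => i _.
by rewrite indicE; case: (_ \in _); rewrite ?normr1 ?normr0.
Qed.

Lemma avg_le_maxfun A n r s :
  avg (\1_A : int -> R) n r s <= maxfun (\1_A : int -> R) n.
Proof.
apply: ub_le_sup; last by exists (r, s).
by exists 1 => _ [[r' s'] _ <-]; exact: avg_indic_le1.
Qed.

Lemma maxfun_le_ub (f : int -> R) n (c : R) :
  (forall r s, avg f n r s <= c) -> maxfun f n <= c.
Proof.
move=> fc; apply: ge_sup; first by exists (avg f n 0 0), (0, 0)%N.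
by move=> _ [[r s] _ <-].
Qed.

Lemma maxfun_indic_ge0 A n : 0 <= maxfun (\1_A : int -> R) n.
Proof. by apply: (le_trans (avg_ge0 _ _ 0 0)); exact: avg_le_maxfun. Qed.

Lemma maxfun_indic_le1 A n : maxfun (\1_A : int -> R) n <= 1.
Proof. by apply: maxfun_le_ub => r s; exact: avg_indic_le1. Qed.

Lemma maxfun_indic_in A n : A n -> maxfun (\1_A : int -> R) n = 1.
Proof.
move=> An; apply/eqP; rewrite eq_le maxfun_indic_le1 /=.
apply: (le_trans _ (avg_le_maxfun A n 0 0)).
by rewrite /avg big_ord1 invr1 mul1r addr0 indicE mem_set// normr1.
Qed.

Lemma avg_recenter (f : int -> R) n m r s r' s' :
  n - r%:Z = m - r'%:Z -> n + s%:Z = m + s'%:Z -> avg f n r s = avg f m r' s'.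
Proof.
move=> e1 e2; have e : (r + s + 1 = r' + s' + 1)%N by lia.
rewrite /avg e; congr (_ * _); apply: eq_bigr => i _.
by congr (`|f _|); lia.
Qed.

(** An interval around [n] which contains [a] or [b] also competes in the
    supremum defining the maximal function there; any other one lies strictly
    between [a] and [b] and has mean 0. *)
Lemma maxfun_quasiconvex A (a n b : int) : a < n -> n < b ->
  (forall m, a < m -> m < b -> ~ A m) ->
  maxfun (\1_A : int -> R) n <=
    Num.max (maxfun (\1_A : int -> R) a) (maxfun (\1_A : int -> R) b).
Proof.
move=> an nb gap; apply: maxfun_le_ub => r s; rewrite le_max.
have [nra|nra] := leP (n - r%:Z) a.
  rewrite (avg_recenter _ n a r s (absz (a - (n - r%:Z))%R) (absz (n + s%:Z - a)%R)); [|lia..].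
  by rewrite avg_le_maxfun.
have [nsb|nsb] := leP b (n + s%:Z).
  rewrite (avg_recenter _ n b r s (absz (b - (n - r%:Z))%R) (absz (n + s%:Z - b)%R)); [|lia..].
  by rewrite avg_le_maxfun orbT.
rewrite [avg _ _ _ _](_ : _ = 0) ?maxfun_indic_ge0//.
rewrite /avg big1 ?mulr0// => i _.
rewrite indicE memNset ?normr0//; apply: gap; have := ltn_ord i; lia.
Qed.

(** By quasiconvexity no value exceeds both end values.  Hence the step next to
    the larger end value goes up towards it, and removing this step lowers both
    the variation and the sum of the end values by the same amount. *)
Lemma wvar_gap A u N : (forall m, u < m -> m < u + N%:Z -> ~ A m) ->
  wvar u N (maxfun (\1_A : int -> R)) <=
    maxfun (\1_A : int -> R) u + maxfun (\1_A : int -> R) (u + N%:Z).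
Proof.
set g := maxfun _; have g0 n : 0 <= g n := maxfun_indic_ge0 A n.
elim: N u => [|N IH] u gap.
  by rewrite /wvar /wsum big_ord0 addr_ge0.
have [uN|uN] := leP (g u) (g (u + N.+1%:Z)).
  have last_up : g (u + N%:Z) <= g (u + N.+1%:Z).
    have [N0|N0] := posnP N; first by have -> : u + N%:Z = u by lia.
    have := @maxfun_quasiconvex A u (u + N%:Z) (u + N.+1%:Z).
    by rewrite -/g (max_r uN); apply=> //; lia.
  have := IH u; rewrite /wvar wsumS /fdiff1 -addrA -PoszD addn1.
  rewrite (ger0_norm (x := g (u + N.+1%:Z) - _)) ?subr_ge0// => H.
  have {}H : wvar u N g <= g u + g (u + N%:Z).
    by apply: H => m um mN; apply: gap => //; lia.
  by move: H; rewrite /wvar /fdiff1; lra.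
have first_down : g (u + 1) <= g u.
  have [N0|N0] := posnP N.
    have -> : u + 1 = u + N.+1%:Z by lia.
    exact: ltW.
  have := @maxfun_quasiconvex A u (u + 1) (u + N.+1%:Z).
  by rewrite -/g (max_l (ltW uN)); apply=> //; lia.
rewrite /wvar wsumSl {1}/fdiff1 ler0_norm ?subr_le0//.
have : wvar (u + 1) N g <= g (u + 1) + g (u + 1 + N%:Z).
  by apply: IH => m um mN; apply: gap; lia.
have -> : u + 1 + N%:Z = u + N.+1%:Z by lia.
by rewrite /wvar; lra.
Qed.

Lemma fdiff1_indic A n : fdiff1 (\1_A : int -> R) n = 0 \/
  `|fdiff1 (\1_A : int -> R) n| = 1.
Proof.
rewrite /fdiff1 !indicE.
case: (_ \in _); case: (_ \in _); rewrite /= ?subrr ?subr0 ?sub0r ?normrN ?normr1; by [left|right].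
Qed.

Lemma indic_eq_of_no_jump A u N : (forall i, (i < N)%N ->
    fdiff1 (\1_A : int -> R) (u + i%:Z) = 0) ->
  forall i, (i <= N)%N -> (\1_A : int -> R) (u + i%:Z) = (\1_A : int -> R) u.
Proof.
move=> h0; elim=> [|i IH] iN; first by rewrite addr0.
have := h0 i iN; rewrite -(IH (ltnW iN)) /fdiff1 => /eqP; rewrite subr_eq0 => /eqP <-.
by congr (\1_A _); lia.
Qed.

(** Between two consecutive jumps the window lies in [A], where the maximal
    function is constant, or in a gap, where [wvar_gap] bounds the variation by 2.
    Cutting at a jump replaces [2] by [2 + 1 + 2], since the step across the
    jump is at most 1 in absolute value; this accounts for the factor 3. *)
Lemma wvar_maxfun_indic A u N :
  wvar u N (maxfun (\1_A : int -> R)) <=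
    2 + 3 * wvar u N (\1_A : int -> R).
Proof.
elim/ltn_ind: N u => N IH u.
set g := maxfun _; have g1 n : g n <= 1 := maxfun_indic_le1 A n.
have g0 n : 0 <= g n := maxfun_indic_ge0 A n.
have v0 v M : 0 <= wvar v M (\1_A : int -> R) by apply: wsum_ge0 => n.
have [nojump|] := pselect (forall i, (i < N)%N ->
    fdiff1 (\1_A : int -> R) (u + i%:Z) = 0).
  have cst := indic_eq_of_no_jump A u N nojump.
  have [Au|nAu] := pselect (A u).
    have allA i : (i <= N)%N -> A (u + i%:Z).
      move=> /cst; rewrite !indicE (mem_set Au).
      have [//|nA] := pselect (A (u + i%:Z)).
      by rewrite memNset//= => /esym/eqP; rewrite oner_eq0.
    rewrite [wvar _ _ g](_ : _ = 0); first by have := v0 u N; lra.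
    rewrite /wvar /wsum big1// => i _.
    rewrite /fdiff1 /g (maxfun_indic_in A (u + i%:Z)); last exact/allA/ltnW/ltn_ord.
    rewrite maxfun_indic_in ?subrr ?normr0//.
    have -> : u + i%:Z + 1 = u + i.+1%:Z by lia.
    exact/allA/ltn_ord.
  have := wvar_gap A u N; rewrite -/g => H.
  have {}H : wvar u N g <= g u + g (u + N%:Z).
    apply: H => m um mN Am; apply: nAu.
    have := cst (absz (m - u)); rewrite !indicE.
    have -> : u + absz (m - u) = m by lia.
    rewrite mem_set// => /(_ _)/esym.
    have [//|nA] := pselect (A u).
    by rewrite memNset//= => e; have /eqP := e ltac:(lia); rewrite eq_sym oner_eq0.
  by have := v0 u N; have := g1 u; have := g1 (u + N%:Z); lra.
move=> /existsNP[i /not_implyP[iN /eqP jump]].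
have jump1 : `|fdiff1 (\1_A : int -> R) (u + i%:Z)| = 1.
  by have [j|//] := fdiff1_indic A (u + i%:Z); rewrite j eqxx in jump.
have -> : N = (i + (1 + (N - i.+1)))%N by lia.
rewrite !wvar_cat {2 5}/wvar !wsum1 jump1.
have H1 := IH i iN u.
have H2 := IH (N - i.+1)%N ltac:(lia) (u + i%:Z + 1%N%:Z).
have H3 : `|fdiff1 g (u + i%:Z)| <= 1.
  rewrite /fdiff1 ler_norml; move: (g0 (u + i%:Z)) (g0 (u + i%:Z + 1)).
  by move: (g1 (u + i%:Z)) (g1 (u + i%:Z + 1)) => ? ? ? ?; apply/andP; split; lra.
by rewrite -/g in H1 H2; lra.
Qed.

End MaximalFunction.

(** * Bounded integer-valued functions *)
Section IntegerValued.
Context {R : realType}.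
Implicit Types (h : int -> R) (u n : int) (k N : nat).

(** A vanishing second difference makes [h] affine on the window.  Its slope is
    an integer, and a nonzero one would move [h] by at least [L.+1], more than
    the bound [B] permits. *)
Lemma fdiff1_eq0_of_second h (B : R) u L :
  (forall n, h n \is a Num.int) -> (forall n, `|h n| <= B) -> 2 * B < L.+1%:R ->
  (forall i, (i < L)%N -> fdiff1 (fdiff1 h) (u + i%:Z) = 0) ->
  forall i, (i < L.+1)%N -> fdiff1 h (u + i%:Z) = 0.
Proof.
move=> hint hB BL d2.
have cst i : (i < L.+1)%N -> fdiff1 h (u + i%:Z) = fdiff1 h u.
  elim: i => [|i IH] iL; first by rewrite addr0.
  rewrite -IH; last exact: ltnW.
  have /eqP := d2 i iL; rewrite {1}/fdiff1 subr_eq0 => /eqP <-.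
  by congr (fdiff1 h _); lia.
suff d0 : fdiff1 h u = 0 by move=> i iL; rewrite cst.
have tot : h (u + L.+1%:Z) - h u = L.+1%:R * fdiff1 h u.
  rewrite -wsum_fdiff1 /wsum (eq_bigr (fun=> fdiff1 h u)).
    by rewrite sumr_const card_ord mulr_natl.
  by move=> i _; rewrite cst.
have dint : fdiff1 h u \is a Num.int by rewrite rpredB.
apply/eqP; apply/negPn/negP => dn0.
have : 1 <= `|fdiff1 h u| by rewrite norm_intr_ge1.
have : L.+1%:R * `|fdiff1 h u| <= 2 * B.
  rewrite -[L.+1%:R]ger0_norm// -normrM -tot (le_trans (ler_normB _ _))//.
  by have := hB u; have := hB (u + L.+1%:Z); lra.
move=> H1 H2; have : L.+1%:R * 1 <= L.+1%:R * `|fdiff1 h u| by rewrite ler_wpM2l.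
lra.
Qed.

Lemma fdiff_int k h : (forall n, h n \is a Num.int) ->
  forall n, fdiff k h n \is a Num.int.
Proof.
move=> hint; elim: k => [|k IH] n; first by rewrite fdiff0.
by rewrite fdiffS rpredB.
Qed.

(** Lowers the order by one at a time, applying [fdiff1_eq0_of_second] to
    [fdiff k h], whose bound [2 ^+ k] dictates the length of the window. *)
Lemma fdiff_eq0_descent k h u L : (forall n, h n \is a Num.int) ->
  (forall n, `|h n| <= 1) -> (2 ^ k.+1 <= L)%N ->
  (forall i, (i < L)%N -> fdiff k.+1 h (u + i%:Z) = 0) ->
  forall i, (i < L)%N -> fdiff1 h (u + i%:Z) = 0.
Proof.
move=> hint hB; elim: k L => [|k IH] L kL dk.
  move=> i iL; rewrite -[RHS](dk i iL) fdiffS /fdiff1 !fdiff0//.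
have k1L : (2 ^ k.+1 <= L)%N by apply: leq_trans kL; rewrite leq_exp2l.
apply: IH => // i iL; rewrite fdiffS.
apply: (fdiff1_eq0_of_second (fdiff k h) (2 ^+ k * 1) u L).
- exact: fdiff_int.
- exact: fdiff_bound.
- rewrite mulr1 -exprS -natrX ltr_nat ltnS//.
- by move=> j jL; rewrite -[RHS](dk j jL) fdiffS /fdiff1 !fdiffS.
- exact: ltnW.
Qed.

End IntegerValued.

(** * Comparison of the two sides on windows *)

Section Jumps.
Context {R : realType}.
Implicit Types (A : set int) (u n : int) (k N : nat).

Lemma fdiff_indic_neq0 A k n : fdiff1 (\1_A : int -> R) n != 0 ->
  exists2 i, (i < 2 ^ k.+1)%N & 1 <= `|fdiff k.+1 (\1_A : int -> R) (n + i%:Z)|.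
Proof.
move=> jump; have indic_int m : (\1_A : int -> R) m \is a Num.int.
  by rewrite indicE natr_int.
have indic_le1 m : `|(\1_A : int -> R) m| <= 1.
  by rewrite indicE; case: (_ \in _); rewrite ?normr1 ?normr0.
apply: contrapT => noi; move/eqP: jump; apply.
have := @fdiff_eq0_descent R k (\1_A) n (2 ^ k.+1) indic_int indic_le1 (leqnn _).
move=> /(_ _ 0%N); rewrite addr0; apply; last by rewrite expn_gt0.
move=> i iL; apply: contrapT => /eqP dn0; apply: noi; exists i => //.
by rewrite norm_intr_ge1// fdiff_int.
Qed.

(** A nonnegative power of the absolute value of a nonzero integer is at least 1,
    so the term supplied by [fdiff_indic_neq0] alone pays for a jump. *)
Lemma fdiff1_le_wsum A k n (r : R) : 0 <= r ->
  `|fdiff1 (\1_A : int -> R) n| <=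
  wsum n (2 ^ k.+1) (fun m => `|fdiff k.+1 (\1_A : int -> R) m| `^ r).
Proof.
move=> r0; have [j0|j1] := fdiff1_indic (R := R) A n.
  by rewrite j0 normr0 wsum_ge0// => m; exact: powR_ge0.
have [|i iL di] := @fdiff_indic_neq0 A k n.
  by rewrite -normr_eq0 j1 oner_eq0.
rewrite j1; apply: (@le_trans _ _ (`|fdiff k.+1 (\1_A : int -> R) (n + i%:Z)| `^ r)).
  by rewrite -[leLHS](powRr0 `|fdiff k.+1 (\1_A : int -> R) (n + i%:Z)|) ler_powR.
rewrite -(wsum1 (n + i%:Z) (fun m => `|fdiff k.+1 (\1_A : int -> R) m| `^ r)).
apply: wsum_sub; [by move=> m; exact: powR_ge0| |]; lia.
Qed.

(** Without a jump, a point of [A] would propagate to the whole half-line on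
    its right. *)
Lemma exists_jump A : finite_set A -> A !=set0 ->
  exists n, fdiff1 (\1_A : int -> R) n != 0.
Proof.
move=> /finite_fsetP[X AX] [a Aa]; apply: contrapT => nojump.
have allA i : A (a + i%:Z).
  elim: i => [|i IH]; first by rewrite addr0.
  have [//|nA] := pselect (A (a + i.+1%:Z)); exfalso; apply: nojump.
  exists (a + i%:Z); rewrite /fdiff1 !indicE (mem_set IH) memNset.
    by rewrite sub0r oppr_eq0 oner_eq0.
  by have -> : a + i%:Z + 1 = a + i.+1%:Z by lia.
pose b := \max_(x <- finmap.enum_fset X) absz x.
have := allA (absz a + b.+1)%N; rewrite AX /= => /(@leq_bigmax_seq _ _ xpredT absz).
by rewrite -/b => /(_ isT); lia.
Qed.

(** The power is convex and vanishes at 0, so it lies below its chord; this reduces the l^r norm of a bounded function to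
    its l^1 norm. *)
Lemma powR_le_linear (x B r : R) : 1 <= r -> 0 <= x -> 0 < B -> x <= B ->
  x `^ r <= B `^ r * x / B.
Proof.
move=> r1 x0 B0 xB; have [->|xn0] := eqVneq x 0.
  rewrite powR0 ?mulr0 ?mul0r//; lra.
have xgt0 : 0 < x by rewrite lt_neqAle eq_sym xn0.
have -> : x `^ r = (x / B) `^ r * B `^ r.
  by rewrite -powRM ?divr_ge0 ?(ltW B0)// divfK// gt_eqF.
rewrite mulrC -mulrA ler_wpM2l ?powR_ge0//.
by apply: ge1r_powR; rewrite ?divr_gt0// ler_pdivrMr// mul1r.
Qed.

(** The first factor comes from [powR_le_linear], the factor [2 ^+ k] from
    [wsum_fdiff], and [2 + 3 * _] from [wvar_maxfun_indic] followed by the count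
    of jumps. *)
Definition window_const k (r : R) : R :=
  (2 ^+ k.+1) `^ r / 2 ^+ k.+1 * (2 ^+ k * (2 + 3 * (2 ^ k.+1)%:R)).

Lemma window_const_ge0 k r : 0 <= window_const k r.
Proof.
by rewrite /window_const !mulr_ge0 ?invr_ge0 ?addr_ge0 ?mulr_ge0 ?powR_ge0 ?exprn_ge0.
Qed.

(** The heart of the proof for finite exponents: the upper and the lower bound
    meet at the variation of [\1_A]. *)
Lemma wsum_fdiff_maxfun A k (r T : R) u N : 1 <= r -> finite_set A -> A !=set0 ->
  (forall v M, wsum v M (fun n => `|fdiff k.+1 (\1_A : int -> R) n| `^ r) <= T) ->
  wsum u N (fun n => `|fdiff k.+1 (maxfun (\1_A : int -> R)) n| `^ r) <=
    window_const k r * T.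
Proof.
move=> r1 finA A0 boundT; set F := fun n => `|fdiff k.+1 (\1_A : int -> R) n| `^ r.
set g := maxfun _; have F0 n : 0 <= F n := powR_ge0 _ _.
have r0 : 0 <= r by lra.
have B0 : 0 < 2 ^+ k.+1 :> R by rewrite exprn_gt0.
have gB n : `|fdiff k.+1 g n| <= 2 ^+ k.+1.
  rewrite -[leRHS]mulr1; apply: fdiff_bound => m.
  by rewrite ger0_norm ?maxfun_indic_ge0// maxfun_indic_le1.
(* Bounds the additive constant 2 of [wvar_maxfun_indic] by [2 * T]. *)
have Tge1 : 1 <= T.
  have [n jn] := exists_jump A finA A0.
  have [j0|j1] := fdiff1_indic (R := R) A n; first by rewrite j0 eqxx in jn.
  rewrite -j1; apply: (le_trans (fdiff1_le_wsum A k n r r0)); exact: boundT.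
(* Each jump is counted in the moving window that starts at it, and each point
   belongs to [2 ^ k.+1] such windows. *)
have VT v M : wvar v M (\1_A : int -> R) <= (2 ^ k.+1)%:R * T.
  apply: (@le_trans _ _ (wsum v M (fun n => wsum n (2 ^ k.+1) F))).
    by apply: wsum_le => n; exact: fdiff1_le_wsum.
  apply: (le_trans (wsum_moving v M (2 ^ k.+1) F F0)).
  by rewrite ler_wpM2l.
apply: (@le_trans _ _ (wsum u N (fun n => (2 ^+ k.+1) `^ r / 2 ^+ k.+1 * `|fdiff k.+1 g n|))).
  apply: wsum_le => n; rewrite mulrAC; exact: powR_le_linear.
rewrite wsum_scale /window_const; set c := _ / _.
rewrite -[leRHS]mulrA; apply: ler_wpM2l; first by rewrite divr_ge0 ?powR_ge0 ?(ltW B0).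
apply: (@le_trans _ _ (wsum u N (fun n => `|fdiff k (fdiff1 g) n|))).
  by apply: wsum_le => n; rewrite fdiff_fdiff1.
apply: (le_trans (wsum_fdiff k u N _)).
rewrite -mulrA ler_wpM2l ?exprn_ge0//.
have := wvar_maxfun_indic (R := R) A u (N + k); rewrite -/g => H.
apply: (le_trans H); have := VT u (N + k)%N; lra.
Qed.

End Jumps.

(** * From windows to the counting measure *)

Section Counting.
Context {R : realType}.
Implicit Types (h : int -> R) (u n : int) (N : nat).

(* Splitting the integers along the injection [pickle] into nat gives cells with
   at most one element, on which integral and sum agree trivially. *)
Let cell (i : nat) : set int := [set x | choice.pickle x = i].

Let trivIset_cell : trivIset setT cell.
Proof. by move=> i j _ _ [x []] /= <- <-. Qed.

Let bigcup_cell : \bigcup_i cell i = setT.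
Proof. by apply/seteqP; split=> // x _; exists (choice.pickle x). Qed.

Lemma counting_set1 (x : int) : counting [set x] = 1%E :> \bar R.
Proof.
by rewrite /counting asboolT// fset_set1 finmap.cardfs1.
Qed.

Lemma integral_counting_int (a : int -> \bar R) : (forall n, 0 <= a n)%E ->
  (\int[counting]_n a n = \esum_(n in setT) a n)%E.
Proof.
move=> a0; rewrite -bigcup_cell.
rewrite ge0_integral_bigcup// esum_bigcupT//.
rewrite nneseries_esumT; last by move=> i; exact: integral_ge0.
apply: eq_esum => i _.
have [->|/set0P[x xi]] := eqVneq (cell i) set0.
  by rewrite integral_set0 esum_set0.
have -> : cell i = [set x].
  apply/seteqP; split=> [y yi|y ->//] /=.
  by apply: (pcan_inj choice.pickleK); rewrite yi xi.
rewrite esum_set1// (eq_integral (cst (a x))).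
  by rewrite integral_cst// -[RHS]mule1; congr (_ * _)%E; exact: counting_set1.
by move=> y; rewrite inE => ->.
Qed.

Lemma wsum_le_integral (h : int -> R) u N : (forall n, 0 <= h n) ->
  ((wsum u N h)%:E <= \int[counting]_n (h n)%:E)%E.
Proof.
move=> h0; rewrite integral_counting_int//.
apply: esum_ge; pose s := [seq u + i%:Z | i <- iota 0 N].
have us : uniq s by rewrite map_inj_uniq ?iota_uniq// => i j; lia.
exists [set` s]; first by split=> //; exact: finite_seq.
rewrite -fsbig_seq// big_map /wsum -sumEFin.
by rewrite -(big_mkord xpredT (fun i => (h (u + i%:Z))%:E)) /index_iota subn0.
Qed.

Lemma integral_le_wsum (h : int -> R) (c : R) : (forall n, 0 <= h n) ->
  (forall u N, wsum u N h <= c) -> (\int[counting]_n (h n)%:E <= c%:E)%E.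
Proof.
move=> h0 hc; rewrite integral_counting_int//.
apply: ge_ereal_sup => _ [X [finX _] <-].
have /finite_fsetP[Y XY] := finX.
pose b := \max_(x <- finmap.enum_fset Y) absz x.
pose s := [seq - b%:Z + i%:Z | i <- iota 0 (b + b).+1].
have us : uniq s by rewrite map_inj_uniq ?iota_uniq// => i j; lia.
apply: (@le_trans _ _ (\sum_(x \in [set` s]) (h x)%:E)%E); last first.
  rewrite -fsbig_seq// big_map sumEFin lee_fin.
  apply: le_trans (hc (- b%:Z) (b + b).+1).
  by rewrite /wsum -(big_mkord xpredT (fun i => h (- b%:Z + i%:Z))) /index_iota subn0.
apply: lee_fsum_nneg_subset => [//|||t _]; [exact: finite_seq| |by rewrite lee_fin].
rewrite XY => x; rewrite !inE /= => xY; apply/mapP.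
have : (absz x <= b)%N := @leq_bigmax_seq _ _ xpredT absz x xY isT.
by move=> xb; exists (absz (x + b%:Z)); [rewrite mem_iota|]; lia.
Qed.

(** Only the empty set is negligible for the counting measure. *)
Lemma ae_counting (P : int -> Prop) :
  (\forall x \ae (@counting _ R : set int -> \bar R), P x) -> forall x, P x.
Proof.
move=> [N [_ N0 PN]] x; apply: contrapT => nPx.
have : (counting [set x] <= counting N :> \bar R)%E.
  by apply: le_measure; rewrite ?inE// => y ->; exact: PN.
by rewrite N0 counting_set1; rewrite leNgt lte_fin ltr01.
Qed.

End Counting.

(** * The norm inequality *)

Section EmptySet.
Context {R : realType}.

Lemma maxfun_set0 n : maxfun (\1_set0 : int -> R) n = 0.
Proof.
apply/eqP; rewrite eq_le maxfun_indic_ge0 andbT; apply: maxfun_le_ub => r s.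
by rewrite /avg big1 ?mulr0// => i _; rewrite indic0 normr0.
Qed.

Lemma lpnorm_fdiff_maxfun_set0 k (p : \bar R) : p != 0%E ->
  lpnorm p (fdiff k (maxfun (\1_set0 : int -> R))) = 0%E.
Proof.
move=> p0; rewrite -(Lnorm0 (@counting _ R : {measure set int -> \bar R}) p0).
apply: eq_Lnorm => n /=; congr (_%:E).
rewrite /fdiff big1// => j _; rewrite maxfun_set0 mulr0//.
Qed.

End EmptySet.

Section Norms.
Context {R : realType}.

Lemma lpnorm_fdiff_maxfun_fin A k (r : R) : 1 <= r -> finite_set A -> A !=set0 ->
  (lpnorm r%:E (fdiff k.+1 (maxfun (\1_A : int -> R)))
    <= (window_const k r `^ r^-1)%:E * lpnorm r%:E (fdiff k.+1 (\1_A : int -> R)))%E.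
Proof.
move=> r1 finA A0; have r0 : 0 < r by lra.
rewrite /lpnorm unlock /=.
set F := (\int[_]_x _)%E; set G := (\int[_]_x _)%E.
have F0 : (0 <= F)%E by apply: integral_ge0 => x _; rewrite lee_fin powR_ge0.
have G0 : (0 <= G)%E by apply: integral_ge0 => x _; rewrite lee_fin powR_ge0.
have C0 := window_const_ge0 (R := R) k r.
have FG : (F <= (window_const k r)%:E * G)%E.
  (* Only a finite integral can serve as the real bound on the window sums. *)
  have [Gfin|Ginf] := boolP (G \is a fin_num); last first.
    move: Ginf; rewrite ge0_fin_numE// -leNgt leye_eq => /eqP ->.
    rewrite gt0_muley ?leey// lte_fin /window_const.
    by rewrite !mulr_gt0 ?invr_gt0 ?addr_gt0 ?mulr_gt0 ?powR_gt0 ?exprn_gt0 ?ltr0n ?expn_gt0.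
  rewrite -(fineK Gfin) -EFinM; apply: integral_le_wsum.
    by move=> n; exact: powR_ge0.
  move=> u N; apply: wsum_fdiff_maxfun => // v M.
  rewrite -lee_fin fineK//; apply: wsum_le_integral => n; exact: powR_ge0.
have e : ((window_const k r `^ r^-1)%:E = (window_const k r)%:E `^ r^-1)%E by [].
rewrite e -poweRM//.
have ri : 0 <= r^-1 by rewrite invr_ge0 ltW.
by apply: gt0_ler_poweR => //; rewrite in_itv/= ?leey ?andbT// mule_ge0.
Qed.

Lemma lpnorm_fdiff_maxfun_infty A k : finite_set A -> A !=set0 ->
  (lpnorm +oo (fdiff k.+1 (maxfun (\1_A : int -> R)))
    <= (2 ^+ k.+1)%:E * lpnorm +oo (fdiff k.+1 (\1_A : int -> R)))%E.
Proof.
move=> finA A0; rewrite /lpnorm unlock /=.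
case: ifPn => _; last by rewrite mule0.
set f := fdiff k.+1 (\1_A).
have fle n : (`|f n|%:E <= ess_sup counting (abse \o (EFin \o f)))%E.
  exact: (ae_counting (fun n => _) (ess_sup_ge _ _)).
apply: (@le_trans _ _ (2 ^+ k.+1)%:E).
  apply/ess_supP; apply: aeW => n /=; rewrite lee_fin -[leRHS]mulr1.
  apply: fdiff_bound => m.
  by rewrite ger0_norm ?maxfun_indic_ge0// maxfun_indic_le1.
have [n jn] := exists_jump (R := R) A finA A0.
have [i _ di] := fdiff_indic_neq0 A k n jn.
rewrite -[leLHS]mule1; apply: lee_pmul => //; rewrite ?lee_fin ?exprn_ge0//.
by apply: (le_trans _ (fle (n + i%:Z))); rewrite lee_fin.
Qed.

End Norms.

Theorem corollary1 (R : realType) (k : nat) (p : \bar R) :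
  (1 <= k)%N -> (1 <= p)%E ->
  exists C : R, forall A : set int, finite_set A ->
    (lpnorm p (fdiff k (maxfun (\1_A : int -> R)))
       <= C%:E * lpnorm p (fdiff k (\1_A : int -> R)))%E.
Proof.
case: k => // k _ p1.
have p0 : p != 0%E by rewrite gt_eqF// (lt_le_trans _ p1)// lte_fin.
suff [C C0 HC] : exists2 C : R, 0 <= C & forall A, finite_set A -> A !=set0 ->
    (lpnorm p (fdiff k.+1 (maxfun (\1_A : int -> R)))
       <= C%:E * lpnorm p (fdiff k.+1 (\1_A : int -> R)))%E.
  exists C => A finA; have [->|/set0P A0] := eqVneq A set0; last exact: HC.
  by rewrite lpnorm_fdiff_maxfun_set0// mule_ge0// Lnorm_ge0.
case: p p1 {p0} => [r| |//] p1.
  exists (window_const k r `^ r^-1); first exact: powR_ge0.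
  by move=> A; exact: lpnorm_fdiff_maxfun_fin.
by exists (2 ^+ k.+1); [rewrite exprn_ge0|move=> A; exact: lpnorm_fdiff_maxfun_infty].
Qed.
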